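(* Let $\mathcal B$ be a Schauder basis in a Banach space $\mathbb X$ over $\mathbb F\in\{\mathbb R,\mathbb C\}$. The following are equivalent: a) $\mathcal B$ is semi-greedy. b) $\mathcal B$ is quasi-greedy and super-democratic. c) $\mathcal B$ is quasi-greedy and disjoint-super-democratic.
   Context: Basis: a sequence $\mathcal B=(e_n)_{n\ge1}$ in $\mathbb X$ with biorthogonal functionals $(e_n^* )_{n\ge1}\subset\mathbb X^*$ which is a semi-normalized strong Markushevich basis, i.e. (a) $0<\inf_n\{\|e_n\|,\|e_n^*\|\}\le\sup_n\{\|e_n\|,\|e_n^*\|\}<\infty$; (b) $e_j^*(e_i)=\delta_{j,i}$; (c) $\mathbb X=\overline{\mathrm{span}}\{e_i:i\in\mathbb N\}$; (d) if $e_j^*(x)=0$ for all $j$ then $x=0$; (e) for every $A\subset\mathbb N$, $\overline{\mathrm{span}}\{e_i:i\in A\}=\{x\in\mathbb X: e_j^*(x)=0\ \forall j\notin A\}$. A Schauder basis is a basis in this sense with $\sup_m\|P_m\|<\infty$, where $P_m(x)=\sum_{j=1}^me_j^*(x)e_j$. A sign is a sequence $\varepsilon=(\varepsilon_n)$ of scalars in $\mathbb F$ with $|\varepsilon_n|=1$; for finite $A\subset\mathbb N$, $\mathbf 1_{\varepsilon A}=\sum_{n\in A}\varepsilon_ne_n$. Greedy sums: for $x\in\mathbb X$, the natural greedy ordering lists indices so that $|e_n^*(x)|$ is non-increasing, with ties broken by putting the smaller index first; $A_m(x)$ is the set of the first $m$ indices, and $\mathcal G_m(x)=\sum_{n\in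 A_m(x)}e_n^*(x)e_n$. The $m$-th Chebyshev-greedy sum $\mathcal{CG}_m(x)$ is any element of $\mathrm{span}\{e_i:i\in A_m(x)\}$ with $\|x-\mathcal{CG}_m(x)\|=\min\{\|x-\sum_{n\in A_m(x)}a_ne_n\|:a_n\in\mathbb F\}$. $\mathcal B$ is quasi-greedy if there is $C>0$ with $\|x-\mathcal G_m(x)\|\le C\|x\|$ for all $x\in\mathbb X$, $m\in\mathbb N$. $\mathcal B$ is semi-greedy if there is $C>0$ with $\|x-\mathcal{CG}_m(x)\|\le C\sigma_m(x)$ for all $x\in\mathbb X$, $m\in\mathbb N$, where $\sigma_m(x)=\inf\{\|x-\sum_{n\in A}a_ne_n\|:A\subset\mathbb N,\ |A|\le m,\ a_n\in\mathbb F\}$. $\mathcal B$ is super-democratic if there is $C>0$ with $\|\mathbf 1_{\varepsilon A}\|\le C\|\mathbf 1_{\varepsilon'B}\|$ for all finite $A,B\subset\mathbb N$ with $|A|\le|B|$ and all signs $\varepsilon,\varepsilon'$. It is disjoint-super-democratic if the inequality is required only for such $A,B$ with $A\cap B=\emptyset$. *)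

(* Defs.v *)
From HB Require Import structures.
From mathcomp Require Import all_boot all_order all_algebra finmap.
From mathcomp Require Import complex.
From mathcomp Require Import all_classical all_reals topology normedtype.
Set Implicit Arguments.
Unset Strict Implicit.
Unset Printing Implicit Defensive.
Import Order.TTheory GRing.Theory Num.Theory.
Import numFieldNormedType.Exports.
Local Open Scope classical_set_scope.
Local Open Scope ring_scope.

(* The scalars K are meant to be R or R[i] for R : realType.  Norms of a
   normedModType K are values in K, so for K = R[i] they are nonnegative reals
   seen as complex numbers.  The (partial) order of R[i] compares only numbers
   with equal imaginary parts; hence infimum and supremum of a set of
   nonnegative reals are the usual ones.  Sequences are indexed from 0: the
   mathematical e_1, e_2, ... are e 0, e 1, ... *)

Section Bases.
Context {K : numFieldType} {X : normedModType K}.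

Definition lin_span (e : nat -> X) (A : set nat) : set X :=
  [set x | exists (B : {fset nat}) (a : nat -> K),
    [set` B] `<=` A /\ x = \sum_(n <- B) a n *: e n].

(* Meaningful for bounded f only: an unbounded f gets the default value 0. *)
Definition opnorm {Y : normedModType K} (f : X -> Y) : K :=
  supremum 0 [set `|f x| | x in [set x : X | `|x| <= 1]].

Definition semi_normalized (e : nat -> X) (es : nat -> {linear X -> K^o}) :=
  let S := range (fun n => `|e n|) `|` range (fun n => opnorm (es n)) in
  0 < infimum 0 S /\ has_ubound S.

Record strong_markushevich_basis (e : nat -> X)
    (es : nat -> {linear X -> K^o}) : Prop := StrongMarkushevichBasis {
  smb_continuous : forall n, continuous (es n);
  smb_semi_normalized : semi_normalized e es;
  smb_biorthogonal : forall i j, es j (e i) = (j == i)%:R;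
  smb_dense : closure (lin_span e setT) = setT;
  smb_total : forall x, (forall j, es j x = 0) -> x = 0;
  smb_strong : forall A : set nat,
    closure (lin_span e A) = [set x | forall j, ~ A j -> es j x = 0] }.

Definition partial_sum (e : nat -> X) (es : nat -> {linear X -> K^o})
    (m : nat) (x : X) : X := \sum_(j < m) es j x *: e j.

Definition schauder_basis (e : nat -> X) (es : nat -> {linear X -> K^o}) :=
  strong_markushevich_basis e es /\
  has_ubound (range (fun m => opnorm (partial_sum e es m))).

Definition is_sign (eps : nat -> K) := forall n, `|eps n| = 1.

Definition signed_indicator (e : nat -> X) (eps : nat -> K) (A : {fset nat}) :=
  \sum_(n <- A) eps n *: e n.

(* i comes strictly before j in the natural greedy ordering of c *)
Definition greedy_before (c : nat -> K) (i j : nat) : Prop :=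
  `|c j| < `|c i| \/ `|c j| = `|c i| /\ (i < j)%N.

(* An index may never be listed (e.g. c j = 0 when c has infinite support);
   such an index must come after every listed one. *)
Definition is_greedy_ordering (c : nat -> K) (rho : nat -> nat) : Prop :=
  (forall i j, (i < j)%N -> greedy_before c (rho i) (rho j)) /\
  (forall i n, ~ range rho n -> greedy_before c (rho i) n).

(* When |c n| tends to 0, as for c n = es n x, there is exactly one such
   ordering, so that the choice made by get is immaterial. *)
Definition greedy_ordering (c : nat -> K) : nat -> nat :=
  get [set rho | is_greedy_ordering c rho].

Definition greedy_set (es : nat -> {linear X -> K^o}) (m : nat) (x : X) :
    {fset nat} :=
  [fset greedy_ordering (fun n => es n x) (val i) | i in 'I_m]%fset.

Definition greedy_sum (e : nat -> X) (es : nat -> {linear X -> K^o})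
    (m : nat) (x : X) : X := \sum_(n <- greedy_set es m x) es n x *: e n.

Definition is_chebyshev_greedy_sum (e : nat -> X)
    (es : nat -> {linear X -> K^o}) (m : nat) (x y : X) : Prop :=
  lin_span e [set` greedy_set es m x] y /\
  forall a : nat -> K,
    `|x - y| <= `|x - \sum_(n <- greedy_set es m x) a n *: e n|.

Definition best_approx_error (e : nat -> X) (m : nat) (x : X) : K :=
  infimum 0 [set r | exists (A : {fset nat}) (a : nat -> K),
    (#|` A| <= m)%N /\ r = `|x - \sum_(n <- A) a n *: e n|].

Definition quasi_greedy (e : nat -> X) (es : nat -> {linear X -> K^o}) :=
  exists2 C : K, 0 < C & forall (x : X) (m : nat), (0 < m)%N ->
    `|x - greedy_sum e es m x| <= C * `|x|.

Definition semi_greedy (e : nat -> X) (es : nat -> {linear X -> K^o}) :=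
  exists2 C : K, 0 < C & forall (x : X) (m : nat), (0 < m)%N ->
    forall y, is_chebyshev_greedy_sum e es m x y ->
      `|x - y| <= C * best_approx_error e m x.

Definition super_democratic (e : nat -> X) :=
  exists2 C : K, 0 < C & forall A B : {fset nat}, (#|` A| <= #|` B|)%N ->
    forall eps eps' : nat -> K, is_sign eps -> is_sign eps' ->
      `|signed_indicator e eps A| <= C * `|signed_indicator e eps' B|.

Definition disjoint_super_democratic (e : nat -> X) :=
  exists2 C : K, 0 < C & forall A B : {fset nat}, (#|` A| <= #|` B|)%N ->
    (A `&` B)%fset = fset0 ->
    forall eps eps' : nat -> K, is_sign eps -> is_sign eps' ->
      `|signed_indicator e eps A| <= C * `|signed_indicator e eps' B|.

End Bases.

(* Main.v *)
(* From b) to a): let A be the greedy set of x, t the least modulus of its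
   coefficients on A, and v = x - z with z supported on B, #B <= m.  Removing
   from v its coefficients of modulus > t costs a constant by quasi-greediness,
   and off A the remainder differs from x only on B \ A, by coefficients of
   modulus <= 2t.  That correction is controlled by t * ||1_(B \ A)||, hence by
   super-democracy by the large coefficients of v, since v = x on A \ B; Abel
   summation along the greedy ordering bounds the latter by ||v||.

   From a) to b): apply the semi-greedy inequality to vectors y + s * 1_D with D
   supported far to the right, and separate y from 1_D by the uniformly bounded
   partial sums.  For quasi-greediness take first y = x and s = t, which gives
   t * ||1_D|| <= C ||x||, then y = x - G_m(x) and s = 2t.

   From c) to b): compare A and B with a third set disjoint from both. *)
Require Import Defs.
From mathcomp Require Import all_boot all_order all_algebra finmap.
From mathcomp Require Import complex.
From mathcomp Require Import ring.
From mathcomp Require Import all_classical all_reals topology normedtype.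
Import Order.TTheory GRing.Theory Num.Theory.
Import numFieldNormedType.Exports.
Local Open Scope classical_set_scope.
Local Open Scope ring_scope.
Local Open Scope complex_scope.

(** * Infima, suprema and operator norms for partially ordered scalars *)

Section OrderedScalars.
Variable K : numFieldType.

(* [K] is [R] or [R[i]]; both have these two properties, which replace
   completeness of the (partial) order and local compactness. *)
Definition nonneg_infima := forall S : set K, S !=set0 ->
  (forall r, S r -> 0 <= r) -> infimums S !=set0.

Definition compact_disks := forall r : K, compact [set z : K | `|z| <= r].

Lemma infimumP (x0 : K) (S : set K) : nonneg_infima -> S !=set0 ->
  (forall r, S r -> 0 <= r) -> infimums S (infimum x0 S).
Proof.
move=> infK S0 Spos; rewrite /infimum ifF; last by apply/negbTE/set0P.
by case: xgetP => [y -> //|]; have [l hl] := infK S S0 Spos => /(_ l).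
Qed.

(** The supremum is the infimum of the upper bounds, which are nonnegative because they dominate an
    element of [S]. *)
Lemma supremumP (x0 : K) (S : set K) : nonneg_infima -> S !=set0 ->
  (forall r, S r -> 0 <= r) -> has_ubound S -> supremums S (supremum x0 S).
Proof.
move=> infK S0 Spos [b hb]; rewrite /supremum ifF; last by apply/negbTE/set0P.
have [s Ss] := S0.
have [|u uS|l [hl1 hl2]] := infK (ubound S); first by exists b.
  exact: le_trans (Spos _ Ss) (uS _ Ss).
have Sl : supremums S l by split=> // r Sr; apply: hl2 => u; exact.
by case: xgetP => [y -> //|/(_ l)].
Qed.

Lemma compact_nonneg_min (T : topologicalType) (A : set T) (f : T -> K) :
  nonneg_infima -> compact A -> A !=set0 -> continuous f -> (forall v, 0 <= f v) ->
  exists v, A v /\ forall w, A w -> f v <= f w.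
Proof.
move=> infK cA [v0 Av0] cf f0.
have cS : compact (f @` A).
  by apply: continuous_compact => //; exact: continuous_subspaceT.
have clS : closed (f @` A) by apply: compact_closed => //; exact: norm_hausdorff.
have [||l [lS lmax]] := infK (f @` A); first by exists (f v0), v0.
  by move=> _ [v _ <-].
have l0 : 0 <= l by apply: lmax => _ [v _ <-].
have [v Av fv] : (f @` A) l.
  apply: clS => U /nbhs_ballP[r /= r0 rU].
  (* Otherwise [l + r], comparable with the values of [f] since all are real, would be a lower bound
     exceeding [l]. *)
  have [s [Ss sl]] : exists s, (f @` A) s /\ s < l + r.
    apply: contrapT => none.
    have : l + r <= l.
      apply: lmax => s Ss; have s0 : 0 <= s by case: Ss => v _ <-.
      have lr0 : 0 <= l + r by rewrite addr_ge0 // ltW.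
      have [//|sl] := real_leP (ger0_real lr0) (ger0_real s0).
      by case: none; exists s.
    by rewrite gerDl => /(lt_le_trans r0); rewrite ltxx.
  exists s; split=> //; apply: rU; rewrite -ball_normE /ball_ /=.
  by rewrite distrC ger0_norm ?subr_ge0 ?lS // ltrBlDl.
by exists v; split=> // w Aw; rewrite fv; apply: lS; exists w.
Qed.

Section OperatorNorm.
Context {X Y : normedModType K}.
Variables (f : X -> Y) (b : K).
Hypothesis infK : nonneg_infima.
Hypothesis fZ : forall a x, f (a *: x) = a *: f x.
Hypothesis fb : forall x, `|f x| <= b * `|x|.

(** The bound [b] is what makes [opnorm] a genuine supremum rather than the default 0. *)
Lemma opnormP : supremums [set `|f x| | x in [set x : X | `|x| <= 1]] (opnorm f).
Proof.
apply: supremumP => //; first by exists `|f 0|, 0 => //=; rewrite normr0.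
  by move=> _ [x _ <-].
(* If [X] is trivial, [b] need not be nonnegative. *)
exists `|b| => _ [x /= x1 <-].
apply: le_trans (fb x) _.
rewrite -(ger0_norm (le_trans (normr_ge0 _) (fb x))) normrM normr_id.
by rewrite ler_piMr.
Qed.

Lemma opnorm_ge0 : 0 <= opnorm f.
Proof.
have h := opnormP.1; apply: le_trans (h `|f 0| _) => //.
by exists 0 => //=; rewrite normr0.
Qed.

Lemma le_opnorm x : `|f x| <= opnorm f * `|x|.
Proof.
have [->|x0] := eqVneq x 0.
  by have := fb 0; rewrite !normr0 !mulr0.
rewrite -ler_pdivrMr ?normr_gt0 //.
have -> : `|f x| / `|x| = `|f (`|x|^-1 *: x)|.
  by rewrite fZ normrZ normfV normr_id mulrC.
apply: opnormP.1; exists (`|x|^-1 *: x) => //=.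
by rewrite normrZ normfV normr_id mulVf // normr_eq0.
Qed.

End OperatorNorm.
End OrderedScalars.

(** * Finite linear combinations and finite index sets *)

Lemma lincomb_continuous {K : numFieldType} {X : normedModType K} (e : nat -> X) N
    (s : seq nat) :
  continuous (fun v : 'rV[K]_N.+1 => \sum_(n <- s) v ord0 (inord n) *: e n).
Proof.
move=> v; rewrite /continuous_at.
apply: (@cvg_big _ _ +%R 0 xpredT add_continuous _ (nbhs v) s
  (fun n (w : 'rV[K]_N.+1) => w ord0 (inord n) *: e n) _ (nbhs_filter v)) => n _.
by apply: cvgZr_tmp; exact: coord_continuous.
Qed.

Lemma dist_lincomb_continuous {K : numFieldType} {X : normedModType K} (e : nat -> X) N
    (s : seq nat) (x : X) :
  continuous (fun v : 'rV[K]_N.+1 => `|x - \sum_(n <- s) v ord0 (inord n) *: e n| : K).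
Proof.
move=> v; rewrite /continuous_at.
apply: (@cvg_norm _ _ _ (nbhs v) (nbhs_filter v)).
apply: (@cvgB _ _ _ (nbhs v) (nbhs_filter v)); first exact: cvg_cst.
exact: lincomb_continuous.
Qed.

Lemma fset_nat_bounded (F : {fset nat}) : exists N, forall n, n \in F -> (n < N)%N.
Proof.
exists (\max_(n <- F) n).+1 => n nF.
by rewrite ltnS; apply: (@leq_bigmax_seq _ _ xpredT (fun n => n)).
Qed.

Lemma far_fset N k : exists D : {fset nat}, #|` D| = k /\
  forall n, n \in D -> (N <= n)%N.
Proof.
exists [fset (N + val i)%N | i in 'I_k]%fset; split.
  rewrite card_imfset /= -?cardE ?card_ord // => i j /addnI; exact: val_inj.
by move=> n /imfsetP[i _ ->]; rewrite leq_addr.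
Qed.

(** * Natural greedy orderings of null sequences *)

Definition vanishing {K : numFieldType} (c : nat -> K) :=
  forall r : K, 0 < r -> exists N, forall n, (N <= n)%N -> `|c n| < r.

Section GreedyOrdering.
Context {K : numFieldType}.
Implicit Types c : nat -> K.

Lemma greedy_before_asym c i j : greedy_before c i j -> ~ greedy_before c j i.
Proof.
move=> [h|[h hij]] [g|[g hji]].
- by have := lt_trans h g; rewrite ltxx.
- by move: h; rewrite g ltxx.
- by move: g; rewrite h ltxx.
- by have := ltn_trans hij hji; rewrite ltnn.
Qed.

Lemma greedy_before_trans c i j k :
  greedy_before c i j -> greedy_before c j k -> greedy_before c i k.
Proof.
move=> [h|[h hij]] [g|[g hjk]].
- by left; exact: lt_trans g h.
- by left; rewrite g.
- by left; rewrite -h.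
- by right; split; [rewrite g|exact: ltn_trans hij hjk].
Qed.

Lemma greedy_before_total c i j :
  i != j -> greedy_before c i j \/ greedy_before c j i.
Proof.
move=> ij; case: (real_ltgtP (normr_real (c i)) (normr_real (c j))) => h.
- by right; left.
- by left; left.
- by move: ij; rewrite neq_ltn => /orP[g|g]; [left|right]; right.
Qed.

Lemma greedy_before_le c i j : greedy_before c i j -> `|c j| <= `|c i|.
Proof. by move=> [/ltW//|[->]]. Qed.

Lemma greedy_first_below c (S : pred nat) N j0 : S j0 -> (j0 < N)%N ->
  exists i, [/\ S i, (i < N)%N &
    forall j, S j -> (j < N)%N -> j != i -> greedy_before c i j].
Proof.
elim: N j0 => [//|N IH] j0 Sj0 j0N.
have [[j1 [Sj1 j1N]]|none] := pselect (exists j1, S j1 /\ (j1 < N)%N); last first.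
  have Nj0 : j0 = N.
    apply/eqP; rewrite eqn_leq -ltnS j0N /= leqNgt; apply/negP => h.
    by apply: none; exists j0.
  subst j0; exists N; split=> // j Sj; rewrite ltnS leq_eqVlt => /orP[/eqP->|jN].
    by rewrite eqxx.
  by case: none; exists j.
have [i [Si iN ifirst]] := IH _ Sj1 j1N.
have below j : S j -> (j < N.+1)%N -> j != N -> j != i -> greedy_before c i j.
  move=> Sj jN jneN ji; apply: ifirst => //.
  by rewrite ltn_neqAle jneN -ltnS.
have iN' : N != i by rewrite gtn_eqF.
have [SN|SN] := boolP (S N); last first.
  exists i; split=> //; first exact: ltnW.
  move=> j Sj jN ji; apply: below => //; apply/eqP => jN'.
  by move: SN; rewrite -jN' Sj.
case: (greedy_before_total c _ _ iN') => h.
- exists N; split=> // j Sj jN jneN.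
  have [->//|ji] := eqVneq j i.
  by apply: (greedy_before_trans _ _ i) => //; apply: below.
- exists i; split=> //; first exact: ltnW.
  by move=> j Sj jN ji; have [->//|jneN] := eqVneq j N; apply: below.
Qed.

(** A nonzero coefficient outside [F] beats all but finitely many others, so the search reduces to a
    finite window. *)
Lemma greedy_first c (F : {fset nat}) : vanishing c ->
  exists i, i \notin F /\
    forall j, j \notin F -> j != i -> greedy_before c i j.
Proof.
move=> c0.
have [[j0 [j0F cj0]]|none] := pselect (exists j, j \notin F /\ c j != 0).
  have /c0[N0 hN0] : 0 < `|c j0| by rewrite normr_gt0.
  pose N := maxn N0 j0.+1.
  have [||i [iF iN ifirst]] := @greedy_first_below c (fun j => j \notin F) N j0 => //.
    by rewrite /N leq_max ltnSn orbT.
  exists i; split=> // j jF ji; have [jN|Nj] := ltnP j N; first exact: ifirst.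
  left; apply: (@lt_le_trans _ _ `|c j0|).
    by apply: hN0; apply: leq_trans Nj; rewrite leq_maxl.
  have [->//|j0i] := eqVneq j0 i.
  apply: greedy_before_le; apply: ifirst => //.
  by rewrite /N leq_max ltnSn orbT.
have cF j : j \notin F -> c j = 0.
  by move=> jF; apply: contrapT => /eqP cj; apply: none; exists j.
have ex : exists n, n \notin F.
  have [N hN] := fset_nat_bounded F; exists N; apply/negP => /hN.
  by rewrite ltnn.
(* All coefficients outside [F] are zero, so the tie rule selects the smallest index. *)
exists (ex_minn ex); case: ex_minnP => i iF imin; split=> // j jF ji.
by right; rewrite !cF //; split=> //; rewrite ltn_neqAle eq_sym ji imin.
Qed.

Lemma greedy_ordering_exists c : vanishing c -> exists rho, is_greedy_ordering c rho.
Proof.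
move=> c0.
have [f fP] := choice (fun F => greedy_first c F c0).
(* [F n] collects the first [n] indices of the ordering; the next one is the greedy choice outside
   [F n]. *)
pose F n := iter n (fun F => (f F |` F)%fset) fset0.
have FS n : F n.+1 = (f (F n) |` F n)%fset by [].
have Fmono i j : (i <= j)%N -> (F i `<=` F j)%fset.
  move=> /subnK <-; elim: (j - i)%N => [|k IH]; first by rewrite add0n.
  by rewrite addSn FS; apply: (fsubset_trans IH); exact: fsubsetU1.
have fF i j : (i < j)%N -> f (F i) \in F j.
  by move=> /Fmono/fsubsetP; apply; rewrite FS fset1U1.
have Frange n k : n \in F k -> exists i, n = f (F i).
  elim: k => [|k IH]; first by rewrite /F /= inE.
  by rewrite FS in_fset1U => /orP[/eqP->|//]; exists k.
exists (fun n => f (F n)); split=> [i j ij|i n nr].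
  apply: (fP (F i)).2.
    apply: contra (fP (F j)).1; move/fsubsetP: (Fmono _ _ (ltnW ij)); exact.
  by apply/eqP => h; have := (fP (F j)).1; rewrite h fF.
apply: (fP (F i)).2.
  by apply/negP => /Frange[k nk]; apply: nr; exists k.
by apply/eqP => h; apply: nr; exists i.
Qed.

Lemma greedy_orderingP c :
  vanishing c -> is_greedy_ordering c (greedy_ordering c).
Proof.
move=> /greedy_ordering_exists[rho h].
by rewrite /greedy_ordering; case: xgetP => [_ -> //|/(_ rho)].
Qed.

Lemma greedy_ordering_inj c : vanishing c -> injective (greedy_ordering c).
Proof.
move=> /greedy_orderingP[h _] i j; case: (ltngtP i j) => // /h g eq.
  by have := g; rewrite eq => /[dup] /greedy_before_asym.
by have := g; rewrite eq => /[dup] /greedy_before_asym.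
Qed.

(** Two different sets of equal size each contain an index missing from the other, and these two
    indices would precede each other. *)
Lemma greedy_initial_unique c (A B : {fset nat}) : #|` A| = #|` B| ->
  (forall i j, i \in A -> j \notin A -> greedy_before c i j) ->
  (forall i j, i \in B -> j \notin B -> greedy_before c i j) -> A = B.
Proof.
move=> cAB hA hB; apply/eqP; rewrite eqEfcard cAB leqnn andbT.
apply/fsubsetP => a aA; apply: contrapT => /negP aB.
have : ~~ (B `<=` A)%fset.
  apply/negP => BA; move: aB.
  by have /eqP -> : B == A; [rewrite eqEfcard BA cAB leqnn|rewrite aA].
move=> /fsubsetPn[b bB bA].
exact: (greedy_before_asym _ _ _ (hA _ _ aA bA) (hB _ _ bB aB)).
Qed.

End GreedyOrdering.

(** * Greedy sets and partial sums in terms of coefficients *)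

Section BasisFacts.
Context {K : numFieldType} {X : normedModType K}.
Variables (e : nat -> X) (es : nat -> {linear X -> K^o}).

Lemma card_greedy_set m x : vanishing (fun n => es n x) ->
  #|` greedy_set es m x| = m.
Proof.
move=> x0; rewrite /greedy_set card_imfset /=; last first.
  by move=> i j /(greedy_ordering_inj _ x0) /val_inj.
by rewrite -cardE card_ord.
Qed.

Lemma greedy_set_initial m x i j : vanishing (fun n => es n x) ->
  i \in greedy_set es m x -> j \notin greedy_set es m x ->
  greedy_before (fun n => es n x) i j.
Proof.
move=> x0 /imfsetP[/= k _ ->] jA; have [hlt hout] := greedy_orderingP _ x0.
have [[l _ jl]|/hout//] := pselect (range (greedy_ordering (fun n => es n x)) j).
rewrite -jl; apply: hlt; rewrite ltnNge; apply: contra jA => lk.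
have lm : (l < m)%N by exact: leq_ltn_trans lk (ltn_ord k).
by apply/imfsetP; exists (Ordinal lm).
Qed.

(** This computes the greedy sets of the test vectors below without enumerating them. *)
Lemma greedy_set_eq m x (A : {fset nat}) : vanishing (fun n => es n x) ->
  #|` A| = m ->
  (forall i j, i \in A -> j \notin A -> greedy_before (fun n => es n x) i j) ->
  greedy_set es m x = A.
Proof.
move=> x0 cA hA; apply: greedy_initial_unique hA; first by rewrite card_greedy_set.
by move=> i j; exact: greedy_set_initial.
Qed.

Lemma greedy_set_threshold m x : vanishing (fun n => es n x) -> (0 < m)%N ->
  exists t : K, [/\ 0 <= t, forall n, n \in greedy_set es m x -> t <= `|es n x| &
    forall n, n \notin greedy_set es m x -> `|es n x| <= t].
Proof.
case: m => // m x0 _; have [hlt hout] := greedy_orderingP _ x0.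
(* The threshold is the modulus listed last in the greedy set. *)
exists `|es (greedy_ordering (fun n => es n x) m) x|; split=> // n.
  move=> /imfsetP[/= k _ ->]; have := ltn_ord k.
  by rewrite ltnS leq_eqVlt => /orP[/eqP->//|/hlt/greedy_before_le].
move=> nA; apply: (greedy_before_le (fun n => es n x)).
apply: greedy_set_initial nA => //.
by apply/imfsetP; exists ord_max.
Qed.

Lemma greedy_sumE m x : vanishing (fun n => es n x) ->
  greedy_sum e es m x = \sum_(j < m)
    es (greedy_ordering (fun n => es n x) j) x
      *: e (greedy_ordering (fun n => es n x) j).
Proof.
move=> x0; rewrite /greedy_sum /greedy_set big_imfset /=; last first.
  by move=> i j _ _ /(greedy_ordering_inj _ x0) /val_inj.
by rewrite big_enum.
Qed.

Lemma signed_indicator_greedy m x eps : vanishing (fun n => es n x) ->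
  signed_indicator e eps (greedy_set es m x) = \sum_(j < m)
    eps (greedy_ordering (fun n => es n x) j)
      *: e (greedy_ordering (fun n => es n x) j).
Proof.
move=> x0; rewrite /signed_indicator /greedy_set big_imfset /=; last first.
  by move=> i j _ _ /(greedy_ordering_inj _ x0) /val_inj.
by rewrite big_enum.
Qed.

Lemma partial_sumB m x y :
  partial_sum e es m (x - y) = partial_sum e es m x - partial_sum e es m y.
Proof.
rewrite /partial_sum -sumrB; apply: eq_bigr => i _.
by rewrite linearB /= scalerBl.
Qed.

Lemma partial_sumZ m a x :
  partial_sum e es m (a *: x) = a *: partial_sum e es m x.
Proof.
rewrite /partial_sum scaler_sumr; apply: eq_bigr => i _.
by rewrite linearZ /= scalerA.
Qed.

Hypothesis bio : forall i j, es j (e i) = (j == i)%:R.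

Lemma coef_fsum (A : {fset nat}) (a : nat -> K) j :
  es j (\sum_(n <- A) a n *: e n) = if j \in A then a j else 0.
Proof.
rewrite linear_sum /=; case: ifPn => [jA|jA].
  rewrite (big_fsetD1 j) //= linearZ /= bio eqxx mulr1n [X in X + _]mulr1.
  rewrite big_seq big1 ?addr0 // => n; rewrite !inE => /andP[nj _].
  by rewrite linearZ /= bio eq_sym (negbTE nj) scaler0.
rewrite big_seq big1 // => n nA; rewrite linearZ /= bio.
case: eqP => [jn|]; last by rewrite scaler0.
by rewrite jn nA in jA.
Qed.

Lemma coef_signed_indicator eps (A : {fset nat}) j :
  es j (signed_indicator e eps A) = if j \in A then eps j else 0.
Proof. exact: coef_fsum. Qed.

Lemma coef_partial_sum m x j :
  es j (partial_sum e es m x) = if (j < m)%N then es j x else 0.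
Proof.
rewrite linear_sum /=; case: ltnP => jm.
  rewrite (bigD1 (Ordinal jm)) //= linearZ /= bio eqxx [X in X + _]mulr1.
  rewrite big1 ?addr0 // => n nj; rewrite linearZ /= bio.
  case: eqP => [jn|]; last by rewrite scaler0.
  by case/eqP: nj; apply: val_inj.
rewrite big1 // => n _; rewrite linearZ /= bio.
case: eqP => [jn|]; last by rewrite scaler0.
by move: (ltn_ord n); rewrite -jn ltnNge jm.
Qed.

Hypothesis total : forall x, (forall j, es j x = 0) -> x = 0.

Lemma coef_inj x y : (forall j, es j x = es j y) -> x = y.
Proof.
move=> h; apply/eqP; rewrite -subr_eq0; apply/eqP/total => j.
by rewrite linearB /= h subrr.
Qed.

Lemma fsum_coef (A : {fset nat}) x : (forall j, j \notin A -> es j x = 0) ->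
  x = \sum_(n <- A) es n x *: e n.
Proof. by move=> xA; apply: coef_inj => j; rewrite coef_fsum; case: ifPn => [//|/xA]. Qed.

Variables (al M : K).
Hypothesis al_gt0 : 0 < al.
Hypothesis le_al : forall n x, `|es n x| <= al * `|x|.
Hypothesis M_gt0 : 0 < M.
Hypothesis le_M : forall m x, `|partial_sum e es m x| <= M * `|x|.
Hypothesis dense : closure (lin_span e setT) = setT.

Lemma finite_approx x r : 0 < r -> exists y N, `|x - y| < r /\
  forall j, (N <= j)%N -> es j y = 0.
Proof.
move=> r0; have : closure (lin_span e setT) x by rewrite dense.
move=> /(_ _ (nbhsx_ballx x r r0))[y [[B [a [_ ->]]]]].
rewrite -ball_normE /ball_ /= => h.
have [N hN] := fset_nat_bounded B.
exists (\sum_(n <- B) a n *: e n), N; split=> // j Nj; rewrite coef_fsum.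
by case: ifPn => // /hN; rewrite ltnNge Nj.
Qed.

(** Beyond the support of a finitely supported approximation [y], the coefficients of [x] are those
    of [x - y], hence small. *)
Lemma coef_vanishing x : vanishing (fun n => es n x).
Proof.
move=> r r0; have [y [N [xy hN]]] := finite_approx x (r / al) (divr_gt0 r0 al_gt0).
exists N => n /hN yn; rewrite -[es n x]subr0 -yn -linearB /=.
by apply: le_lt_trans (le_al _ _) _; rewrite -ltr_pdivlMl // mulrC.
Qed.

Lemma partial_sum_id m x : (forall j, (m <= j)%N -> es j x = 0) ->
  partial_sum e es m x = x.
Proof.
move=> hx; apply: coef_inj => j; rewrite coef_partial_sum.
by case: ltnP => // /hx.
Qed.

Lemma partial_sum_approx x r : 0 < r -> exists N, forall m, (N <= m)%N ->
  `|x - partial_sum e es m x| <= r.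
Proof.
move=> r0; have M1 : 0 < 1 + M by rewrite addr_gt0.
have [y [N [xy hN]]] := finite_approx x (r / (1 + M)) (divr_gt0 r0 M1).
exists N => m Nm.
(* The partial sum of order [m] fixes [y], so only [x - y] contributes to the remainder. *)
have -> : x - partial_sum e es m x = (x - y) - partial_sum e es m (x - y).
  rewrite partial_sumB (partial_sum_id m y) ?opprB ?addrA ?subrK // => j mj.
  by apply: hN; exact: leq_trans mj.
apply: le_trans (ler_normB _ _) _.
apply: (@le_trans _ _ ((1 + M) * `|x - y|)); first by rewrite mulrDl mul1r lerD2l.
by rewrite -ler_pdivlMl // mulrC ltW.
Qed.

Lemma le_remainder m x : `|x - partial_sum e es m x| <= (1 + M) * `|x|.
Proof. by apply: le_trans (ler_normB _ _) _; rewrite mulrDl mul1r lerD2l. Qed.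

(** Comparing coefficients isolates the part of a vector left of a cut without computing a partial
    sum; [le_tail] does so on the right. *)
Lemma le_head (N : nat) x y : (forall j, (j < N)%N -> es j x = es j y) ->
  (forall j, (N <= j)%N -> es j y = 0) -> `|y| <= M * `|x|.
Proof.
move=> hlt hge; suff -> : y = partial_sum e es N x by [].
apply: coef_inj => j; rewrite coef_partial_sum.
by case: ltnP => [/hlt|/hge].
Qed.

Lemma le_tail (N : nat) x y : (forall j, (N <= j)%N -> es j x = es j y) ->
  (forall j, (j < N)%N -> es j y = 0) -> `|y| <= (1 + M) * `|x|.
Proof.
move=> hge hlt; suff -> : y = x - partial_sum e es N x by exact: le_remainder.
apply: coef_inj => j; rewrite linearB /= coef_partial_sum.
by case: ltnP => [/[dup]/hlt -> _|/hge ->]; rewrite ?subrr ?subr0.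
Qed.

(** * Convexity in the coefficients and Abel summation *)

Lemma signed_sum_le u L (s : seq nat) : uniq s ->
  (forall eps, is_sign eps -> `|u + \sum_(n <- s) eps n *: e n| <= L) ->
  forall a : nat -> K, (forall n, n \in s -> `|a n| <= 1) ->
    `|u + \sum_(n <- s) a n *: e n| <= L.
Proof.
(* The vector [u] absorbs the coefficients already treated, so each step moves a single sign into
   the disk. *)
elim: s u => [|k s IH] u /= us hL a ha.
  have := hL (fun=> 1) (fun=> normr1 _).
  by rewrite !big_nil.
case/andP: us => ks us; rewrite big_cons addrA; apply: IH => //; last first.
  by move=> n ns; apply: ha; rewrite inE ns orbT.
move=> eps heps.
have hs (z : K) : `|z| = 1 -> `|u + z *: e k + \sum_(n <- s) eps n *: e n| <= L.
  move=> z1; pose eps' n := if n == k then z else eps n.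
  have heps' : is_sign eps' by move=> n; rewrite /eps'; case: ifP.
  have := hL eps' heps'; rewrite big_cons addrA {1}/eps' eqxx.
  rewrite (@eq_big_seq _ _ _ _ _ _ (fun n => eps n *: e n)) // => n ns.
  by rewrite /eps'; case: eqP => // nk; rewrite -nk ns in ks.
have ak : `|a k| <= 1 by apply: ha; rewrite mem_head.
(* [a k] lies on the segment between the two signs [z] and [- z]. *)
have [z z1 az] : exists2 z, `|z| = 1 & a k = `|a k| * z.
  have [a0|a0] := eqVneq (a k) 0; first by exists 1; rewrite ?normr1// a0 normr0 mul0r.
  exists (a k / `|a k|); first by rewrite normrM normfV normr_id divff // normr_eq0.
  by rewrite mulrC divfK // normr_eq0.
have hz := hs _ z1; have hNz := hs (- z) (etrans (normrN z) z1).
set v := \sum_(n <- s) _ in hz hNz *.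
have [p [q [p0 q0 pq pq']]] : exists p q : K,
    [/\ 0 <= p, 0 <= q, p + q = 1 & p - q = `|a k|].
  exists ((1 + `|a k|) / 2), ((1 - `|a k|) / 2); split; try by field.
  - by rewrite divr_ge0 // addr_ge0.
  - by rewrite divr_ge0 // subr_ge0.
have -> : u + a k *: e k + v = p *: (u + z *: e k + v) + q *: (u + - z *: e k + v).
  rewrite !scalerDr !scalerA addrACA -scalerDl pq scale1r.
  rewrite addrACA -scalerDl pq scale1r -scalerDl.
  by rewrite mulrN -mulrBl pq' -az.
apply: le_trans (ler_normD _ _) _; rewrite !normrZ (ger0_norm p0) (ger0_norm q0).
have -> : L = p * L + q * L by rewrite -mulrDl pq mul1r.
by apply: lerD; rewrite ler_wpM2l.
Qed.

Lemma bounded_sum_le (E : {fset nat}) L t (a : nat -> K) : 0 < t ->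
  (forall eps, is_sign eps -> t * `|signed_indicator e eps E| <= L) ->
  (forall n, n \in E -> `|a n| <= t) -> `|\sum_(n <- E) a n *: e n| <= L.
Proof.
move=> t0 hL ha.
have -> : \sum_(n <- E) a n *: e n = t *: (0 + \sum_(n <- E) (t^-1 * a n) *: e n).
  rewrite add0r scaler_sumr; apply: eq_bigr => n _.
  by rewrite scalerA mulVKf // gt_eqF.
rewrite normrZ gtr0_norm // mulrC -ler_pdivlMr //.
apply: signed_sum_le => //; first exact: fset_uniq.
  by move=> eps /hL; rewrite add0r ler_pdivlMr // mulrC.
move=> n nE; rewrite normrM normfV (gtr0_norm t0).
by rewrite ler_pdivrMl // mulr1 ha.
Qed.

Lemma abel_bound (w : nat -> K) (S : nat -> X) L k : S 0%N = 0 -> 0 <= L ->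
  (forall j, (j <= k.+1)%N -> `|S j| <= L) -> (forall j, (j <= k)%N -> 0 <= w j) ->
  (forall j, (j < k)%N -> w j <= w j.+1) ->
  `|\sum_(j < k.+1) w j *: (S j.+1 - S j)| <= 2 * w k * L.
Proof.
move=> S0 L0 hS hw hmono.
set T := fun k => \sum_(j < k.+1) w j *: (S j.+1 - S j).
(* The difference equals the sum of [(w j.+1 - w j) *: S j.+1] over [j < k], whose weights are
   nonnegative and telescope. *)
suff H : `|w k *: S k.+1 - T k| <= (w k - w 0%N) * L.
  rewrite -/(T k) -[T k](subKr (w k *: S k.+1)).
  apply: le_trans (ler_normB _ _) _.
  have -> : 2 * w k * L = w k * L + w k * L by ring.
  apply: lerD.
    by rewrite normrZ ger0_norm ?hw // ler_wpM2l ?hw ?hS.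
  by apply: le_trans H _; rewrite ler_wpM2r // lerBlDr lerDl hw.
have : (k <= k)%N by []; move: {-2}k; elim=> [|i IH] ik.
  by rewrite /T big_ord1 S0 !subr0 subrr normr0 subrr mul0r.
have -> : w i.+1 *: S i.+2 - T i.+1
    = (w i.+1 - w i) *: S i.+1 + (w i *: S i.+1 - T i).
  have -> : T i.+1 = T i + w i.+1 *: (S i.+2 - S i.+1) by rewrite /T big_ord_recr.
  rewrite scalerBr scalerBl [RHS]addrA subrK opprD opprB addrCA.
  by rewrite [w _ *: S i.+2 + _]addrC subrK addrC.
apply: le_trans (ler_normD _ _) _.
apply: (@le_trans _ _ ((w i.+1 - w i) * L + (w i - w 0%N) * L)); last first.
  by rewrite -mulrDl addrA subrK.
apply: lerD; last by apply: IH; exact: ltnW.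
by rewrite normrZ ger0_norm ?subr_ge0 ?hmono // ler_wpM2l ?subr_ge0 ?hmono // hS // ltnW.
Qed.

(** * From quasi-greedy and super-democratic to semi-greedy *)

Section QuasiGreedySuperDemocratic.
Variables (C D : K).
Hypothesis C_gt0 : 0 < C.
Hypothesis D_gt0 : 0 < D.
Hypothesis qg : forall (x : X) (m : nat), (0 < m)%N ->
    `|x - greedy_sum e es m x| <= C * `|x|.
Hypothesis sd : forall A B : {fset nat}, (#|` A| <= #|` B|)%N ->
    forall eps eps' : nat -> K, is_sign eps -> is_sign eps' ->
      `|signed_indicator e eps A| <= D * `|signed_indicator e eps' B|.

Lemma greedy_sum_le x m : `|greedy_sum e es m x| <= (1 + C) * `|x|.
Proof.
case: m => [|m].
  rewrite greedy_sumE; last exact: coef_vanishing.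
  by rewrite big_ord0 normr0 mulr_ge0 // addr_ge0 // ltW.
rewrite -[greedy_sum _ _ _ _](subKr x); apply: le_trans (ler_normB _ _) _.
by rewrite mulrDl mul1r lerD2l qg.
Qed.

(** Dividing each greedy term by its modulus produces a signed indicator. These weights are
    nondecreasing along the ordering and at most 1/t, and the partial sums are greedy sums, so
    [abel_bound] applies. *)
Lemma greedy_indicator_le v k t : 0 < t ->
  (forall n, n \in greedy_set es k v -> t <= `|es n v|) ->
  exists2 eta, is_sign eta &
    t * `|signed_indicator e eta (greedy_set es k v)| <= 2 * (1 + C) * `|v|.
Proof.
move=> t0 ht; have v0 := coef_vanishing v.
(* These are the signs of the coefficients; the value 1 at a zero coefficient keeps [eta] a sign
   everywhere. *)
exists (fun n => if es n v == 0 then 1 else es n v / `|es n v|).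
  move=> n; case: eqP => [_|/eqP vn]; first exact: normr1.
  by rewrite normrM normfV normr_id divff // normr_eq0.
rewrite signed_indicator_greedy //; set rho := greedy_ordering _.
case: k ht => [|k] ht.
  by rewrite big_ord0 normr0 mulr0 !mulr_ge0 // addr_ge0 // ltW.
have hk j : (j <= k)%N -> t <= `|es (rho j) v|.
  by move=> jk; apply: ht; apply/imfsetP; exists (Ordinal (jk : (j < k.+1)%N)).
have hk0 j : (j <= k)%N -> 0 < `|es (rho j) v|.
  by move=> /hk; exact: lt_le_trans.
rewrite (eq_bigr (fun j : 'I_k.+1 => `|es (rho j) v|^-1
    *: (greedy_sum e es j.+1 v - greedy_sum e es j v))); last first.
  move=> j _; have jk : (j <= k)%N by rewrite -ltnS.
  rewrite !greedy_sumE // big_ord_recr /= addrAC subrr add0r scalerA.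
  by rewrite -normr_eq0 gt_eqF ?hk0 // mulrC.
rewrite mulrC -ler_pdivlMr //; apply: le_trans.
  apply: (@abel_bound (fun j => `|es (rho j) v|^-1) (fun j => greedy_sum e es j v)
     ((1 + C) * `|v|)).
  - by rewrite greedy_sumE // big_ord0.
  - by rewrite mulr_ge0 // addr_ge0 // ltW.
  - by move=> j _; exact: greedy_sum_le.
  - by move=> j jk; rewrite invr_ge0.
  - move=> j jk; rewrite lef_pV2 ?posrE ?hk0 //; last exact: ltnW.
    apply: (greedy_before_le (fun n => es n v)).
    by apply: (greedy_orderingP _ v0).1.
have -> : 2 * (1 + C) * `|v| / t = 2 * t^-1 * ((1 + C) * `|v|) by ring.
apply: ler_wpM2r; first by rewrite mulr_ge0 // addr_ge0 // ltW.
by rewrite ler_pM2l // lef_pV2 ?posrE ?hk0 ?hk.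
Qed.

(** [F] is replaced by the greedy set of the same size, whose coefficients also have modulus at
    least [t]; super-democracy then passes from that set to [E]. *)
Lemma large_coef_indicator_le v t (E F : {fset nat}) eps : 0 < t -> is_sign eps ->
  (#|` E| <= #|` F|)%N -> (forall n, n \in F -> t <= `|es n v|) ->
  t * `|signed_indicator e eps E| <= D * (2 * (1 + C) * `|v|).
Proof.
move=> t0 heps EF hF; have v0 := coef_vanishing v.
have cL := card_greedy_set #|` F| v v0; set L := greedy_set es _ v in cL.
have hL n : n \in L -> t <= `|es n v|.
  move=> nL; have [//|lt] := real_leP (gtr0_real t0) (normr_real (es n v)).
  (* With a coefficient on [L] below [t], no index of [F] could be missing from [L], and equal sizes
     would force [F = L]. *)
  have FL : (F `<=` L)%fset.
    apply/fsubsetP => f fF; apply: contrapT => /negP fL.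
    have /greedy_before_le := greedy_set_initial _ _ _ _ v0 nL fL.
    by move=> /(le_trans (hF _ fF))/le_lt_trans/(_ lt); rewrite ltxx.
  have /eqP FL' : F == L by rewrite eqEfcard FL cL leqnn.
  have nF : n \in F by rewrite FL'.
  by have := le_lt_trans (hF n nF) lt; rewrite ltxx.
have [eta heta etaL] := greedy_indicator_le v #|` F| t t0 hL.
apply: (@le_trans _ _ (D * (t * `|signed_indicator e eta L|))); last first.
  by rewrite ler_pM2l.
rewrite mulrCA ler_pM2l //; apply: sd => //; by rewrite cL.
Qed.

Lemma greedy_support_approx x m (B : {fset nat}) (b : nat -> K) :
  (0 < m)%N -> (#|` B| <= m)%N ->
  exists a, `|x - \sum_(n <- greedy_set es m x) a n *: e n|
    <= (1 + C + 2 * (D * (2 * (1 + C)))) * `|x - \sum_(n <- B) b n *: e n|.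
Proof.
move=> m0 Bm; have x0 := coef_vanishing x.
set v := x - \sum_(n <- B) _.
have v0 := coef_vanishing v.
have C1 : 0 < 1 + C by rewrite addr_gt0.
have [t [t_ge0 tA tnA]] := greedy_set_threshold m x x0 m0.
have cA := card_greedy_set m x x0.
set A := greedy_set es m x in tA tnA cA *.
(* For [t = 0] the vector [x] vanishes off [A] and is its own approximant. *)
have [t0|t_neq0] := eqVneq t 0.
  exists (fun n => es n x); rewrite -fsum_coef; last first.
    by move=> j /tnA; rewrite t0 normr_le0 => /eqP.
  rewrite subrr normr0 mulr_ge0 // addr_ge0 //; first exact: ltW.
  by rewrite !mulr_ge0 // ltW.
have t_gt0 : 0 < t by rewrite lt0r t_neq0.
have es_v j : es j v = es j x - if j \in B then b j else 0.
  by rewrite linearB /= coef_fsum.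
have [N hN] := v0 t t_gt0.
(* The strict inequality makes [L] a greedy set of [v] whatever the ties; it is finite because the
   coefficients tend to 0. *)
have [L LP] : exists L : {fset nat}, forall n, (n \in L) = (t < `|es n v|).
  exists [fset n in iota 0 N | t < `|es n v|]%fset => n.
  rewrite !inE /= mem_iota /= add0n; apply: andb_idl => h.
  by rewrite ltnNge; apply/negP => /hN /(lt_trans h); rewrite ltxx.
have le_t n : n \notin L -> `|es n v| <= t.
  by rewrite LP -real_leNgt // ger0_real.
have LE : greedy_set es #|` L| v = L.
  apply: greedy_set_eq => // i j iL /le_t jt; left; apply: le_lt_trans jt _.
  by rewrite -LP.
have qL : `|v - \sum_(n <- L) es n v *: e n| <= (1 + C) * `|v|.
  have [L0|L0] := posnP #|` L|.
    rewrite (cardfs0_eq L0) big_nil subr0 mulrDl mul1r lerDl.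
    by rewrite mulr_ge0 // ltW.
  have := qg v _ L0; rewrite /greedy_sum LE => /le_trans; apply.
  by rewrite ler_wpM2r // lerDr.
set E := (B `\` A)%fset.
(* On [E] these corrections replace what remains of [v] after removing [L] by the coefficients of
   [x]; both have modulus at most [t]. *)
pose d n := es n x - if n \in L then 0 else es n v.
have hd : `|\sum_(n <- E) d n *: e n| <= 2 * (D * (2 * (1 + C) * `|v|)).
  apply: (bounded_sum_le E _ (2 * t)); first by rewrite mulr_gt0.
    move=> eps heps; rewrite -[leLHS]mulrA ler_pM2l //.
    (* Since [B] is no larger than [A], neither is B minus A larger than A minus B, and on the
       latter [v] has the coefficients of [x]. *)
    apply: (large_coef_indicator_le v t E (A `\` B)%fset) => //.
      rewrite -(leq_add2l #|` (A `&` B)%fset|) cardfsID fsetIC cardfsID.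
      by rewrite cA.
    move=> n; rewrite !inE => /andP[nB nA]; rewrite es_v (negbTE nB) subr0.
    exact: tA.
  move=> n; rewrite !inE => /andP[nA nB]; apply: le_trans (ler_normB _ _) _.
  have -> : 2 * t = t + t by ring.
  apply: lerD; first exact: tnA.
  case: ifPn => [_|/le_t//].
  by rewrite normr0.
(* [u] agrees with [x] off [A]: on [E] by the correction, elsewhere because [v] agrees with [x]
   there and [L] contains no such index. Hence [x - u] is a combination over the greedy set. *)
set u := v - \sum_(n <- L) es n v *: e n + \sum_(n <- E) d n *: e n.
exists (fun n => es n (x - u)); rewrite -fsum_coef; last first.
  move=> j jA; rewrite linearB linearD linearB /= !coef_fsum /d es_v !inE jA /=.
  case: ifPn => [jB|jB].
    by case: ifP => jL; rewrite ?subrr ?add0r ?subr0 ?(addrC (_ - b j)) ?subrK subrr.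
  rewrite subr0; case: ifPn => [|_]; last by rewrite subr0 addr0 subrr.
  rewrite LP es_v (negbTE jB) subr0 => /lt_le_trans/(_ (tnA _ jA)).
  by rewrite ltxx.
rewrite subKr; apply: le_trans (ler_normD _ _) _.
rewrite mulrDl; apply: lerD; first exact: qL.
by rewrite -!mulrA in hd *.
Qed.

End QuasiGreedySuperDemocratic.

(** * From semi-greedy to quasi-greedy and super-democratic *)

Section SemiGreedy.
Variable C : K.
Hypothesis C_gt0 : 0 < C.
Hypothesis sg : forall (x : X) (m : nat), (0 < m)%N ->
  exists a : nat -> K, forall (B : {fset nat}) (b : nat -> K), (#|` B| <= m)%N ->
    `|x - \sum_(n <- greedy_set es m x) a n *: e n|
      <= C * `|x - \sum_(n <- B) b n *: e n|.

(** The factor 2 makes [D] the greedy set of [x], deleting the indicator of [A] is an admissible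
    competitor, and the partial sum up to [N] recovers that indicator. *)
Lemma semi_greedy_near_le_far eps eta (A D : {fset nat}) N :
  is_sign eps -> is_sign eta -> (#|` A| <= #|` D|)%N -> (0 < #|` D|)%N ->
  (forall n, n \in A -> (n < N)%N) -> (forall n, n \in D -> (N <= n)%N) ->
  `|signed_indicator e eps A| <= M * (C * (2 * `|signed_indicator e eta D|)).
Proof.
move=> heps heta AD D0 AN DN.
have nDA n : n \in A -> n \in D = false.
  by move=> /AN nN; apply/negP => /DN; rewrite leqNgt nN.
pose x := signed_indicator e eps A + 2 *: signed_indicator e eta D.
have es_x n : es n x = (if n \in A then eps n else 0)
    + 2 * (if n \in D then eta n else 0).
  by rewrite linearD linearZ /= !coef_signed_indicator.
have gx : greedy_set es #|` D| x = D.
  apply: greedy_set_eq => //; first exact: coef_vanishing.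
  move=> i j iD jD; left; rewrite !es_x iD (negbTE jD) mulr0 addr0.
  have -> : i \in A = false by apply/negP => /nDA; rewrite iD.
  rewrite /= add0r normrM heta normr_nat mulr1.
  by case: ifP => _; rewrite ?heps ?normr0 ?ltr1n ?ltr0n.
have [a ha] := sg x _ D0; rewrite gx in ha.
apply: (@le_trans _ _ (M * `|x - \sum_(n <- D) a n *: e n|)).
  apply: (le_head N) => j.
    move=> jN; have jD : j \in D = false.
      by apply/negP => /DN; rewrite leqNgt jN.
    by rewrite linearB /= coef_fsum coef_signed_indicator es_x jD mulr0 subr0 addr0.
  move=> Nj; rewrite coef_signed_indicator; case: ifP => // /AN.
  by rewrite ltnNge Nj.
rewrite ler_pM2l //; apply: le_trans (ha A eps AD) _.
rewrite ler_pM2l // /x -/(signed_indicator e eps A) addrAC subrr add0r.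
by rewrite normrZ normr_nat.
Qed.

(** Now the near set is doubled, and the tail from [N] on recovers the indicator of [D]. *)
Lemma semi_greedy_far_le_near eps eta (B D : {fset nat}) N :
  is_sign eps -> is_sign eta -> (#|` D| <= #|` B|)%N -> (0 < #|` B|)%N ->
  (forall n, n \in B -> (n < N)%N) -> (forall n, n \in D -> (N <= n)%N) ->
  `|signed_indicator e eta D| <= (1 + M) * (C * (2 * `|signed_indicator e eps B|)).
Proof.
move=> heps heta DB B0 BN DN.
have nDB n : n \in B -> n \in D = false.
  by move=> /BN nN; apply/negP => /DN; rewrite leqNgt nN.
pose x := signed_indicator e eta D + 2 *: signed_indicator e eps B.
have es_x n : es n x = (if n \in D then eta n else 0)
    + 2 * (if n \in B then eps n else 0).
  by rewrite linearD linearZ /= !coef_signed_indicator.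
have gx : greedy_set es #|` B| x = B.
  apply: greedy_set_eq => //; first exact: coef_vanishing.
  move=> i j iB jB; left; rewrite !es_x iB (negbTE jB) mulr0 addr0 (nDB i iB).
  rewrite /= add0r normrM heps normr_nat mulr1.
  by case: ifP => _; rewrite ?heta ?normr0 ?ltr1n ?ltr0n.
have [a ha] := sg x _ B0; rewrite gx in ha.
apply: (@le_trans _ _ ((1 + M) * `|x - \sum_(n <- B) a n *: e n|)).
  apply: (le_tail N) => j.
    move=> Nj; have jB : j \in B = false.
      by apply/negP => /BN; rewrite ltnNge Nj.
    by rewrite linearB /= coef_fsum coef_signed_indicator es_x jB mulr0 subr0 addr0.
  move=> jN; rewrite coef_signed_indicator; case: ifP => // /DN.
  by rewrite leqNgt jN.
rewrite ler_pM2l ?addr_gt0 //; apply: le_trans (ha D eta DB) _.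
rewrite ler_pM2l // /x -/(signed_indicator e eta D) addrAC subrr add0r.
by rewrite normrZ normr_nat.
Qed.

Lemma semi_greedy_super_democratic : super_democratic e.
Proof.
exists (M * (C * (2 * ((1 + M) * (C * 2))))); first by rewrite !mulr_gt0 // addr_gt0.
move=> A B AB eps eps' heps heps'.
have [B0|B0] := posnP #|` B|.
  move: AB; rewrite B0 leqn0 => /eqP A0.
  rewrite (cardfs0_eq A0) (cardfs0_eq B0) /signed_indicator.
  by rewrite !big_nil normr0 mulr0.
have [N hN] := fset_nat_bounded (A `|` B)%fset.
(* [A] is compared with [D], then [D] with [B]. *)
have [D [cD hD]] := far_fset N #|` B|.
have one : is_sign (fun=> 1 : K) by move=> n; exact: normr1.
have nA n : n \in A -> (n < N)%N by move=> nA; apply: hN; rewrite inE nA.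
have nB n : n \in B -> (n < N)%N by move=> nB; apply: hN; rewrite inE nB orbT.
apply: le_trans (semi_greedy_near_le_far eps (fun=> 1) A D N _ _ _ _ _ _) _;
  rewrite ?cD //.
rewrite -!mulrA !ler_pM2l //.
by apply: (semi_greedy_far_le_near eps' (fun=> 1) B D N); rewrite ?cD.
Qed.

(** Finite support leaves room on the right for a set [D] on which both [x] and its greedy sum
    vanish. *)
Lemma semi_greedy_finite_le x m N : (0 < m)%N ->
  (forall j, (N <= j)%N -> es j x = 0) ->
  `|x - greedy_sum e es m x|
    <= M * (C * (1 + 2 * ((1 + M) * C))) * `|x|.
Proof.
move=> m0 xN0; have x0 := coef_vanishing x.
have cA := card_greedy_set m x x0.
have [t [t_ge0 tA tnA]] := greedy_set_threshold m x x0 m0.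
rewrite /greedy_sum; set A := greedy_set es m x in cA tA tnA *.
have M1 : 0 < 1 + M by rewrite addr_gt0.
have [t0|t_neq0] := eqVneq t 0.
  rewrite -fsum_coef ?subrr ?normr0; last first.
    by move=> j /tnA; rewrite t0 normr_le0 => /eqP.
  rewrite !mulr_ge0 ?addr_ge0 ?mulr_ge0 ?addr_ge0 //; exact: ltW.
have t_gt0 : 0 < t by rewrite lt0r t_neq0.
have [N' hN'] := fset_nat_bounded A.
have [D [cD hD]] := far_fset (maxn N N') m.
have xN0' j : (maxn N N' <= j)%N -> es j x = 0.
  by rewrite geq_max => /andP[/xN0].
have {}xN0 j : j \in D -> es j x = 0 by move=> /hD /xN0'.
have AN j : j \in A -> (j < maxn N N')%N.
  by move=> /hN' h; rewrite leq_max h orbT.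
have AD j : j \in A -> j \in D = false.
  by move=> /AN nN; apply/negP => /hD; rewrite leqNgt nN.
pose d := \sum_(n <- D) t *: e n.
have es_d j : es j d = if j \in D then t else 0 by rewrite coef_fsum.
have d_le : `|d| <= (1 + M) * C * `|x|.
  pose z := x + d.
  have es_z j : es j z = es j x + if j \in D then t else 0.
    by rewrite linearD /= es_d.
  (* Adding [t] on [D] keeps [A] greedy, since ties are won by the smaller indices of [A].
     Cancelling [d] is then a competitor that leaves [x]. *)
  have gz : greedy_set es m z = A.
    apply: greedy_set_eq => //; first exact: coef_vanishing.
    move=> i j iA jA; rewrite /greedy_before !es_z (AD i iA) addr0.
    have [jD|jD] := boolP (j \in D); last first.
      by rewrite addr0; apply: (greedy_set_initial m).
    rewrite xN0 // add0r (gtr0_norm t_gt0).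
    have := tA _ iA; rewrite le_eqVlt => /orP[/eqP <-|]; last by left.
    by right; split=> //; apply: leq_trans (AN _ iA) (hD _ jD).
  have [a ha] := sg z _ m0; rewrite gz in ha.
  apply: (@le_trans _ _ ((1 + M) * `|z - \sum_(n <- A) a n *: e n|)).
    apply: (le_tail (maxn N N')) => j.
      move=> Nj; have jA : j \in A = false.
        by apply/negP => /AN; rewrite ltnNge Nj.
      rewrite linearB /= coef_fsum jA subr0 es_z es_d xN0' ?add0r //.
    move=> jN; rewrite es_d; case: ifP => // /hD.
    by rewrite leqNgt jN.
  rewrite -mulrA ler_pM2l //; apply: le_trans (ha D (fun=> t) _) _; first by rewrite cD.
  by rewrite -/d addrK.
pose z := x - \sum_(n <- A) es n x *: e n + 2 *: d.
have es_z j : es j z = (es j x - if j \in A then es j x else 0)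
    + 2 * (if j \in D then t else 0).
  by rewrite linearD linearB linearZ /= coef_fsum es_d.
(* The height [2 * t] exceeds every coefficient left after removing [A], so [D] becomes the greedy
   set. *)
have gz : greedy_set es m z = D.
  apply: greedy_set_eq => //; first exact: coef_vanishing.
  move=> i j iD jD; left; rewrite !es_z iD (negbTE jD) mulr0 addr0.
  have -> : i \in A = false by apply/negP => /AD; rewrite iD.
  rewrite (xN0 i iD) /= subr0 add0r normrM normr_nat (gtr0_norm t_gt0).
  apply: (@le_lt_trans _ _ t); last by rewrite ltr_pMl // ltr1n.
  by case: ifPn => [|/tnA]; rewrite ?subrr ?normr0 // subr0.
have [a ha] := sg z _ m0; rewrite gz in ha.
apply: (@le_trans _ _ (M * `|z - \sum_(n <- D) a n *: e n|)).
  apply: (le_head (maxn N N')) => j.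
    move=> jN; have jD : j \in D = false.
      by apply/negP => /hD; rewrite leqNgt jN.
    by rewrite linearB /= coef_fsum es_z jD mulr0 subr0 addr0 linearB /= coef_fsum.
  move=> Nj; rewrite linearB /= coef_fsum.
  case: ifPn => [/AN|_]; first by rewrite ltnNge Nj.
  by rewrite xN0' // subr0.
rewrite -[leRHS]mulrA ler_pM2l //.
(* This competitor restores [x + 2 *: d], which [d_le] controls. *)
apply: le_trans (ha A (fun n => - es n x) _) _; first by rewrite cA.
rewrite -[leRHS]mulrA ler_pM2l //.
have -> : z - \sum_(n <- A) - es n x *: e n = x + 2 *: d.
  have -> : \sum_(n <- A) - es n x *: e n = - \sum_(n <- A) es n x *: e n.
    by rewrite -sumrN; apply: eq_bigr => n _; rewrite scaleNr.
  by rewrite opprK addrAC subrK.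
apply: le_trans (ler_normD _ _) _; rewrite mulrDl mul1r lerD2l.
by rewrite normrZ normr_nat -[leRHS]mulrA ler_pM2l.
Qed.

Lemma semi_greedy_quasi_greedy : quasi_greedy e es.
Proof.
have M1 : 0 < 1 + M by rewrite addr_gt0.
pose C' := M * (C * (1 + 2 * ((1 + M) * C))).
have C'0 : 0 < C' by rewrite !mulr_gt0 // addr_gt0 // !mulr_gt0.
exists (1 + C' * M); first by rewrite addr_gt0 // mulr_gt0.
move=> x m m0; have [->|x_neq0] := eqVneq x 0.
  rewrite /greedy_sum big1 ?subr0 ?normr0 ?mulr0 // => n _.
  by rewrite linear0 scale0r.
have x0 := coef_vanishing x.
(* The tolerance |x|, positive as [x] is nonzero, accounts for the summand 1 of the constant. *)
have [N hN] := partial_sum_approx x `|x| (etrans (normr_gt0 x) x_neq0).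
have [N' hN'] := fset_nat_bounded (greedy_set es m x).
set Q := maxn N N'; set p := partial_sum e es Q x.
have es_p j : es j p = if (j < Q)%N then es j x else 0 by exact: coef_partial_sum.
have AQ j : j \in greedy_set es m x -> (j < Q)%N.
  by move=> /hN' h; rewrite leq_max h orbT.
(* Truncating beyond the greedy set preserves it: discarded coefficients become zero, and ties with
   zero favour the smaller index. *)
have gp : greedy_set es m p = greedy_set es m x.
  apply: greedy_set_eq; [exact: coef_vanishing|exact: card_greedy_set|].
  move=> i j iA jA; rewrite /greedy_before !es_p (AQ i iA).
  case: ltnP => jQ; first exact: (greedy_set_initial m).
  have [->|xi] := eqVneq (es i x) 0.
    by right; rewrite normr0; split=> //; exact: leq_trans (AQ _ iA) jQ.
  by left; rewrite normr0 normr_gt0.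
have Gp : greedy_sum e es m p = greedy_sum e es m x.
  rewrite /greedy_sum gp; apply: eq_big_seq => n nA.
  by rewrite es_p AQ.
rewrite -Gp -(subrK p x) -addrA; apply: le_trans (ler_normD _ _) _.
rewrite (subrK p x) mulrDl mul1r; apply: lerD; first exact: hN (leq_maxl _ _).
apply: (@le_trans _ _ (C' * `|p|)).
  apply: (semi_greedy_finite_le p m Q) => // j Qj.
  by rewrite es_p ltnNge Qj.
by rewrite -[leRHS]mulrA ler_pM2l //; exact: le_M.
Qed.

End SemiGreedy.

(** * Existence of Chebyshev sums and reformulation of semi-greediness *)

Lemma best_coefficients_exist (x : X) (A : {fset nat}) :
  nonneg_infima K -> compact_disks K ->
  exists a : nat -> K, forall b : nat -> K,
    `|x - \sum_(n <- A) a n *: e n| <= `|x - \sum_(n <- A) b n *: e n|.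
Proof.
move=> infK ballK.
have [N hN] := fset_nat_bounded A.
pose f (v : 'rV[K]_N.+1) : K := `|x - \sum_(n <- A) v ord0 (inord n) *: e n|.
(* A combination at distance at most |x| from [x] has norm at most 2|x|, so its coefficients lie in
   the disk of radius [r]. *)
pose r := al * (2 * `|x|).
pose box := [set v : 'rV[K]_N.+1 | forall i, [set z : K | `|z| <= r] (v ord0 i)].
have cbox : compact box by exact: (rV_compact (fun=> ballK r)).
have r0 : 0 <= r by rewrite !mulr_ge0 // ltW.
have box0 : box 0 by move=> i /=; rewrite mxE normr0.
have cf : continuous f by exact: dist_lincomb_continuous.
have f0 v : 0 <= f v by exact: normr_ge0.
have [|v [_ vmin]] := @compact_nonneg_min _ _ box f infK cbox _ cf f0.
  by exists 0.
exists (fun n => v ord0 (inord n)) => b.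
(* A farther combination loses to the zero combination, which lies in the box. *)
have [small|] := boolP (`|x - \sum_(n <- A) b n *: e n| <= `|x|); last first.
  rewrite -real_ltNge ?normr_real // => /ltW; apply: le_trans.
  suff <- : f 0 = `|x| by exact: vmin.
  by rewrite /f big1 ?subr0 // => n _; rewrite mxE scale0r.
pose w : 'rV[K]_N.+1 := \row_i if val i \in A then b i else 0.
have fw : f w = `|x - \sum_(n <- A) b n *: e n|.
  rewrite /f; congr `|_ - _|; apply: eq_big_seq => n nA.
  have nN : (n < N.+1)%N by rewrite ltnS ltnW // hN.
  by rewrite /w mxE /= inordK // nA.
have := vmin w; rewrite fw; apply => i /=; rewrite /w mxE -coef_fsum.
apply: le_trans (le_al _ _) _; rewrite ler_pM2l //.
rewrite -[X in `|X|](subKr x); apply: le_trans (ler_normB _ _) _.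
have -> : 2 * `|x| = `|x| + `|x| by ring.
by rewrite lerD2l.
Qed.

Lemma best_approx_errorP x m : nonneg_infima K ->
  infimums [set r | exists (A : {fset nat}) (a : nat -> K),
    (#|` A| <= m)%N /\ r = `|x - \sum_(n <- A) a n *: e n|] (best_approx_error e m x).
Proof.
move=> infK; apply: infimumP => //; last by move=> r [A [a [_ ->]]].
exists `|x - \sum_(n <- (fset0 : {fset nat})) 0 *: e n|.
by exists fset0, (fun=> 0); rewrite cardfs0.
Qed.

(** The existence of a Chebyshev sum gives semi-greediness content, and the infimum is replaced by
    arbitrary competitors, as in the test vector arguments. *)
Lemma semi_greedy_approx : nonneg_infima K -> compact_disks K ->
  semi_greedy e es -> exists2 C : K, 0 < C & forall (x : X) (m : nat), (0 < m)%N ->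
  exists a : nat -> K, forall (B : {fset nat}) (b : nat -> K), (#|` B| <= m)%N ->
    `|x - \sum_(n <- greedy_set es m x) a n *: e n|
      <= C * `|x - \sum_(n <- B) b n *: e n|.
Proof.
move=> infK ballK [C C0 sg]; exists C => // x m m0.
have [a ha] := best_coefficients_exist x (greedy_set es m x) infK ballK.
exists a => B b Bm; apply: le_trans (sg x m m0 _ _) _.
  by split=> //; exists (greedy_set es m x), a; split.
rewrite ler_pM2l //; apply: (best_approx_errorP x m infK).1.
by exists B, b.
Qed.

(** The combination may depend on the competitor, because a Chebyshev sum is at least as good as all
    combinations over the greedy set at once. *)
Lemma semi_greedy_of_approx C : nonneg_infima K -> 0 < C ->
  (forall (x : X) (m : nat) (B : {fset nat}) (b : nat -> K), (0 < m)%N ->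
    (#|` B| <= m)%N ->
    exists a, `|x - \sum_(n <- greedy_set es m x) a n *: e n|
      <= C * `|x - \sum_(n <- B) b n *: e n|) ->
  semi_greedy e es.
Proof.
move=> infK C0 H; exists C => // x m m0 y [_ ymin].
rewrite -ler_pdivrMl //; apply: (best_approx_errorP x m infK).2.
move=> r [B [b [Bm ->]]]; rewrite ler_pdivrMl //.
by have [a ha] := H x m B b m0 Bm; exact: le_trans (ymin a) ha.
Qed.

End BasisFacts.

(** * Uniform bounds of a Schauder basis and the equivalences *)

Section BasisConstants.
Context {K : numFieldType} {X : normedModType K}.
Variables (e : nat -> X) (es : nat -> {linear X -> K^o}).

Lemma schauder_basis_bounds : nonneg_infima K -> schauder_basis e es ->
  exists al M : K, [/\ 0 < al, forall n x, `|es n x| <= al * `|x|,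
    0 < M & forall m x, `|partial_sum e es m x| <= M * `|x|].
Proof.
move=> infK [[cont [_ [b hb]] _ _ _ _] [b' hb']].
(* [opnorm] controls a map only once some bound is known: continuity provides it here, and
   [P_bounded] for the partial sums. *)
have es_bounded n : exists r, forall x, `|es n x| <= r * `|x|.
  have /linear_boundedP/pinfty_ex_gt0[r _ hr] :=
    continuous_linear_bounded 0 (cont n 0).
  by exists r.
have b0 : 0 <= b by apply: le_trans (hb `|e 0%N| _) => //; left; exists 0%N.
have le_es n x : `|es n x| <= b * `|x|.
  have [r hr] := es_bounded n.
  have esZ a z : es n (a *: z) = a *: es n z by rewrite linearZ.
  apply: le_trans (le_opnorm _ _ _ infK esZ hr x) _; apply: ler_wpM2r => //.
  by apply: hb; right; exists n.
have P_bounded m x : `|partial_sum e es m x| <= (\sum_(j < m) b * `|e j|) * `|x|.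
  apply: le_trans (ler_norm_sum _ _ _) _; rewrite mulr_suml; apply: ler_sum => j _.
  by rewrite normrZ mulrAC ler_wpM2r.
have le_P m x : `|partial_sum e es m x| <= b' * `|x|.
  apply: le_trans (le_opnorm _ _ _ infK (partial_sumZ e es m) (P_bounded m) x) _.
  by apply: ler_wpM2r => //; apply: hb'; exists m.
have b'0 : 0 <= b'.
  apply: le_trans (opnorm_ge0 _ _ _ infK (P_bounded 0%N)) _.
  by apply: hb'; exists 0%N.
exists (1 + b), (1 + b'); split=> [|n x||m x]; rewrite ?ltr_wpDr //.
  by apply: le_trans (le_es n x) _; rewrite ler_wpM2r // lerDr.
by apply: le_trans (le_P m x) _; rewrite ler_wpM2r // lerDr.
Qed.

Lemma disjoint_super_democratic_super_democratic :
  disjoint_super_democratic e -> super_democratic e.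
Proof.
move=> [C C0 hC]; exists (C * C); first exact: mulr_gt0.
move=> A B AB eps eps' heps heps'.
have [N hN] := fset_nat_bounded (A `|` B)%fset.
have [D [cD hD]] := far_fset N #|` B|.
have disj (F : {fset nat}) : (F `<=` A `|` B)%fset -> (F `&` D)%fset = fset0.
  move=> /fsubsetP FAB; apply/fsetP => n; rewrite !inE; apply/negP => /andP[nF nD].
  by have := hN _ (FAB _ nF); rewrite ltnNge hD.
have one : is_sign (fun=> 1 : K) by move=> n; exact: normr1.
apply: (@le_trans _ _ (C * `|signed_indicator e (fun=> 1) D|)).
  by apply: hC; rewrite ?cD ?disj ?fsubsetUl.
rewrite -mulrA ler_pM2l //; apply: hC; rewrite ?cD //.
by rewrite fsetIC disj // fsubsetUr.
Qed.

Lemma super_democratic_disjoint :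
  super_democratic e -> disjoint_super_democratic e.
Proof. by move=> [C C0 hC]; exists C => // A B AB _; exact: hC. Qed.

Lemma semi_greedy_equivalences : nonneg_infima K -> compact_disks K ->
  schauder_basis e es ->
  [<-> semi_greedy e es;
       quasi_greedy e es /\ super_democratic e;
       quasi_greedy e es /\ disjoint_super_democratic e].
Proof.
move=> infK ballK be; have [al [M [al0 le_al M0 le_M]]] := schauder_basis_bounds infK be.
have [[_ _ bio dense total _] _] := be.
have b_to_a : quasi_greedy e es /\ super_democratic e -> semi_greedy e es.
  move=> [[C C0 qg] [D D0 sd]].
  apply: (semi_greedy_of_approx e es (1 + C + 2 * (D * (2 * (1 + C)))) infK).
    by rewrite !addr_gt0 // !mulr_gt0 // addr_gt0.
  exact: (greedy_support_approx e es bio total al al0 le_al dense C D).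
tfae.
- move=> /(semi_greedy_approx e es bio al al0 le_al infK ballK)[C C0 sg]; split.
    exact: (semi_greedy_quasi_greedy e es bio total al M al0 le_al M0 le_M dense C).
  exact: (semi_greedy_super_democratic e es bio total al M al0 le_al M0 le_M dense C).
- by move=> [qg /super_democratic_disjoint].
- by move=> [qg /disjoint_super_democratic_super_democratic sd]; apply: b_to_a.
Qed.

End BasisConstants.

(** * The real and complex scalar fields *)

Section RealAndComplexScalars.
Variable R : realType.

Lemma real_nonneg_infima : nonneg_infima R.
Proof.
move=> S S0 Spos.
have infS : has_inf S by split=> //; exists 0 => r; exact: Spos.
exists (inf S); split=> [r Sr|l lS]; first by apply: ge_inf => //; case: infS.
exact: lb_le_inf.
Qed.

Lemma real_compact_disks : compact_disks R.
Proof.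
move=> r; have := @segment_compact R (- r) r; congr compact.
by apply/seteqP; split=> z /=; rewrite in_itv /= ler_norml.
Qed.

Lemma complex_nonneg_infima : nonneg_infima R[i].
Proof.
move=> S S0 Spos.
have ReK s : S s -> s = (complex.Re s)%:C.
  by move=> /Spos/ger0_Im; case: s => a b /= ->.
have [||l [lS lmax]] := real_nonneg_infima (@complex.Re R @` S).
- by case: S0 => s Ss; exists (complex.Re s), s.
- by move=> _ [s /Spos + <-]; rewrite lecE => /andP[].
have [s0 Ss0] := S0.
exists l%:C; split=> [s Ss|u uS].
  by rewrite (ReK s Ss) lecR; apply: lS; exists s.
(* The lower bound [u] is comparable with the real number [s0], hence real. *)
have := uS s0 Ss0; rewrite {1}(ReK s0 Ss0) lecE /= => /andP[/eqP uIm _].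
rewrite lecE /= uIm eqxx /=; apply: lmax => _ [s Ss <-].
by have := uS s Ss; rewrite lecE => /andP[].
Qed.

Lemma complex_norm_le (z : R[i]) : `|z| <= (`|complex.Re z| + `|complex.Im z|)%:C.
Proof.
rewrite normc_def lecR -[leRHS]ger0_norm ?addr_ge0 // -sqrtr_sqr ler_wsqrtr //.
rewrite sqrrD !real_normK ?num_real // -addrA lerD2l lerDr.
by rewrite mulrn_wge0 // mulr_ge0.
Qed.

(** Pairs carry the product topology and complex numbers that of the modulus; [complex_norm_le]
    links the two. *)
Lemma complex_of_pair_continuous :
  continuous ((fun p => (p.1 +i* p.2)%C) : R * R -> (R[i] : numFieldType)).
Proof.
move=> p; apply/(@cvgrPdist_lt _ _ _ (nbhs p)) => r r0.
have rE : r = (complex.Re r)%:C.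
  by case: r r0 => a b; rewrite ltcE /= => /andP[/eqP ->].
have Rer : 0 < complex.Re r by move: r0; rewrite {1}rE ltcR.
have h0 : 0 < complex.Re r / 2 by rewrite divr_gt0.
apply/nbhs_ballP; exists (complex.Re r / 2) => //= q [].
rewrite /ball /= /ball_ => d1 d2.
apply: le_lt_trans (complex_norm_le _) _.
by rewrite rE ltcR /= [complex.Re r]splitr ltrD.
Qed.

Lemma disk_closed (K : numFieldType) (r : K) : r \is Num.real ->
  closed [set z : K | `|z| <= r].
Proof.
move=> rr z zcl /=; have [//|rz] := real_leP (normr_real z) rr.
have d0 : 0 < `|z| - r by rewrite subr_gt0.
have [y [/= yr]] := zcl _ (nbhsx_ballx z _ d0).
rewrite -ball_normE /ball_ /= ltrBrDr => zy.
have := le_lt_trans (lerD (lexx `|z - y|) yr) zy.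
have := ler_normD (z - y) y; rewrite subrK => /le_lt_trans h /h.
by rewrite ltxx.
Qed.

(** The disk is a closed part of the continuous image of a compact square. *)
Lemma complex_compact_disks : compact_disks R[i].
Proof.
(* Unless [r] is a nonnegative real, the disk is empty. *)
move=> r; have [r0|r0] := boolP (0 <= r); last first.
  rewrite (_ : [set _ | _] = set0); first exact: compact0.
  apply/seteqP; split=> // z /= /(le_trans (normr_ge0 z)) h.
  by rewrite h in r0.
pose a := complex.Re r.
have rE : r = a%:C by have := ger0_Im r0; rewrite /a; case: r {r0 a} => ? ? /= ->.
pose g (p : R * R) : (R[i] : numFieldType) := (p.1 +i* p.2)%C.
apply: (@subclosed_compact _ _ (g @` ([set` `[- a, a]] `*` [set` `[- a, a]]))).
- exact/disk_closed/ger0_real.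
- apply: continuous_compact.
    exact/continuous_subspaceT/complex_of_pair_continuous.
  by apply: compact_setX; exact: segment_compact.
- move=> [x y] /=; rewrite rE normc_def lecR /= => h.
  exists (x, y) => //; rewrite /= !in_itv /= -!ler_norml -!sqrtr_sqr.
  by split; apply: le_trans h; rewrite ler_wsqrtr // ?lerDl ?lerDr sqr_ge0.
Qed.

End RealAndComplexScalars.

Theorem corollary1p13 (R : realType) :
  (forall (X : completeNormedModType R)
     (e : nat -> X) (es : nat -> {linear X -> R^o}),
   schauder_basis e es ->
   [<-> semi_greedy e es;
        quasi_greedy e es /\ super_democratic e;
        quasi_greedy e es /\ disjoint_super_democratic e])
  /\
  (forall (X : completeNormedModType R[i])
     (e : nat -> X) (es : nat -> {linear X -> R[i]^o}),
   schauder_basis e es ->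
   [<-> semi_greedy e es;
        quasi_greedy e es /\ super_democratic e;
        quasi_greedy e es /\ disjoint_super_democratic e]).
Proof.
split=> X e es be; apply: semi_greedy_equivalences be.
- exact: real_nonneg_infima.
- exact: real_compact_disks.
- exact: complex_nonneg_infima.
- exact: complex_compact_disks.
Qed.
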